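(* Let $t$ and $r$ be distinct primes, let $s$ be a power of $t$, and let $\alpha\geq 1$ be an integer. The number of conjugacy classes (in ${\rm GL}(\alpha,s)$) of subgroups that are maximal amongst the subgroups of ${\rm GL}(\alpha, s)$ which are in $\mathfrak{A}_r$ is at most $1$.
   Context: ${\rm GL}(\alpha,s)$ is the group of invertible $\alpha\times\alpha$ matrices over the field $\mathbb{F}_s$ with $s$ elements. $\mathfrak{A}_r$ is the variety of abelian groups of exponent dividing $r$. Maximality is with respect to inclusion in the set of all subgroups of ${\rm GL}(\alpha,s)$ that belong to $\mathfrak{A}_r$. *)

(* Defs.v *)
From HB Require Import structures.
From mathcomp Require Import all_boot all_order all_algebra all_fingroup all_solvable.

Set Implicit Arguments.
Unset Strict Implicit.
Unset Printing Implicit Defensive.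

Local Open Scope group_scope.

Definition in_abelian_exponent (r : nat) (gT : finGroupType) (H : {group gT})
    : bool :=
  abelian H && (exponent H %| r)%N.

Definition maximal_abelian_exponent (r : nat) (gT : finGroupType)
    (G : {group gT}) : {set {group gT}} :=
  [set H : {group gT} |
    [max H of K | (K \subset G) && in_abelian_exponent r K]].

Definition conjugacy_classes (gT : finGroupType) (G : {group gT})
    (S : {set {group gT}}) : {set {set {group gT}}} :=
  [set orbit 'JG G H | H : {group gT} in S].

(* Main.v *)
Require Import Defs.
From mathcomp Require Import all_boot all_order all_algebra all_fingroup all_solvable.
From mathcomp Require Import finfield mxrepresentation.

(* Let d be minimal such that some d x d matrix A <> 1 satisfies A^r = 1. By
   minimality A is irreducible. If an abelian group G with G^r = 1 acts
   nontrivially on F^n, averaging with weights A^(jk) (a discrete Fourier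
   transform) yields a nonzero, hence injective, T : F^d -> F^n on which every
   element of G acts through a power of A; Maschke's theorem splits it off. By
   induction on n, G is conjugate into one fixed abelian group of exponent r,
   consisting of block diagonal matrices whose blocks are powers of A followed by
   an identity block. Every maximal subgroup is thus a conjugate of that one. *)

(** * Powers of matrices satisfying [X ^+ r = 1] *)

Section FiniteOrderMatrices.

Import GRing.Theory.
Local Set Implicit Arguments.
Local Unset Strict Implicit.
Local Unset Printing Implicit Defensive.
Local Open Scope ring_scope.

Variables (F : fieldType) (r : nat).
Hypotheses (r_pr : prime r) (r_neq0 : r%:R != 0 :> F).

Let r_gt0 : (0 < r)%N := prime_gt0 r_pr.

Lemma basis_of_rank m n k (W : 'M[F]_(m, n)) :
  \rank W = k -> exists2 N : 'M_(k, n), row_free N & (N :=: W)%MS.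
Proof.
by move=> <-; exists (row_base W); [exact: row_base_free | exact: eq_row_base].
Qed.

Lemma expmx_mul n (A : 'M[F]_n) i j : A ^+ i *m A ^+ j = A ^+ (i + j).
Proof. by rewrite exprD. Qed.

Lemma expmx_modr n (A : 'M[F]_n) i : A ^+ r = 1 -> A ^+ (i %% r) = A ^+ i.
Proof. by move=> Ar; rewrite {2}(divn_eq i r) exprD mulnC exprM Ar expr1n mul1r. Qed.

(** As [r] is prime, [i] is invertible modulo [r]; its inverse serves as [l]. *)
Lemma expmx_root n (A : 'M[F]_n) i :
  A ^+ r = 1 -> ~~ (r %| i)%N -> exists l, A = (A ^+ i) ^+ l.
Proof.
move=> Ar ri; have i_gt0 : (0 < i)%N by case: i ri => [|//]; rewrite dvdn0.
have [l m Elm _] := egcdnP r i_gt0.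
have Eg : gcdn i r = 1%N.
  by apply/eqP; rewrite gcdnC -[_ == _]/(coprime r i) prime_coprime.
exists l; rewrite -exprM mulnC Elm Eg exprD mulnC exprM Ar expr1n mul1r.
by rewrite expr1.
Qed.

Lemma expmx_intertwine m n (B : 'M[F]_m) (X : 'M[F]_n) (T : 'M_(m, n)) k :
  B *m T = T *m X -> B ^+ k *m T = T *m X ^+ k.
Proof.
move=> BT; elim: k => [|k IHk]; first by rewrite !expr0 mul1mx mulmx1.
by rewrite !exprSr -!mulmxE -mulmxA BT mulmxA IHk -mulmxA.
Qed.

Lemma restrict_exp1 m n (B : 'M[F]_m) (X : 'M[F]_n) (T : 'M_(m, n)) :
  row_free T -> B *m T = T *m X -> X ^+ r = 1 -> B ^+ r = 1.
Proof.
move=> fT BT Xr; apply: (row_free_inj fT).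
by rewrite (expmx_intertwine _ BT) Xr mulmx1 mul1mx.
Qed.

(** * Irreducibility of a nontrivial root of the identity of least size *)

Section MinimalDegree.

Variables (d : nat) (A : 'M[F]_d).
Hypotheses (Ar : A ^+ r = 1) (A_neq1 : A != 1).
Hypothesis d_min : forall e (B : 'M[F]_e), (e < d)%N -> B ^+ r = 1 -> B = 1.

(** In a basis [N] of the row space of [W], [X] acts by a matrix [B] of size below [d] with
    [B ^+ r = 1], so minimality of [d] gives [B = 1]. *)
Lemma small_stable_fixed m n (W : 'M[F]_(m, n)) (X : 'M[F]_n) :
  X ^+ r = 1 -> (\rank W < d)%N -> (W *m X <= W)%MS -> W *m X = W.
Proof.
move=> Xr rW sWX; have [N fN eN] := basis_of_rank (erefl (\rank W)).
have sNX : (N *m X <= N)%MS by rewrite eN (submx_trans _ sWX) // submxMr // eN.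
have [B EB] := submxP sNX.
have B1 : B = 1 by apply: d_min rW _; apply: restrict_exp1 fN (esym EB) Xr.
have: (W <= N)%MS by rewrite eN.
by case/submxP=> Y ->; rewrite -mulmxA EB B1 mul1mx.
Qed.

(** Otherwise the row space of [A - 1] is stable of dimension below [d], hence fixed by [A]. Every
    term of [(A - 1)(1 + A + ... + A^(r-1)) = A^r - 1 = 0] is then [A - 1], so [r (A - 1) = 0] and
    [A = 1]. *)
Lemma sub1_unit : A - 1 \in unitmx.
Proof.
apply/contraR: A_neq1; rewrite -row_full_unit => nf.
have rk : (\rank (A - 1)%R < d)%N by rewrite ltn_neqAle rank_leq_row andbT.
have fixA : (A - 1) * A = A - 1.
  rewrite -mulmxE; apply: small_stable_fixed => //.
  have -> : (A - 1) *m A = A *m (A - 1).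
    by rewrite mulmxE mulrBl mulrBr mul1r mulr1.
  exact: submxMl.
have fixX k : (A - 1) * A ^+ k = A - 1.
  by elim: k => [|k IHk]; rewrite ?mulr1 // exprS mulrA fixA.
have := subrX1 A r; rewrite Ar subrr mulr_sumr.
rewrite (eq_bigr (fun=> A - 1)) // sumr_const card_ord -scaler_nat => /esym/eqP.
by rewrite scaler_eq0 (negPf r_neq0) subr_eq0.
Qed.

(** [A] is a power of [A ^+ i], so [A ^+ i - 1] is a factor of the unit [A - 1]. *)
Lemma subX1_unit i : ~~ (r %| i)%N -> A ^+ i - 1 \in unitmx.
Proof.
case/(expmx_root Ar) => l El; have := sub1_unit.
by rewrite {1}El subrX1 -mulmxE unitmx_mul => /andP[].
Qed.

Lemma sum_powers0 i : ~~ (r %| i)%N -> \sum_(k < r) A ^+ (i * k) = 0.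
Proof.
move=> ri; have := subrX1 (A ^+ i) r.
rewrite -exprM mulnC exprM Ar expr1n subrr.
move=> /esym/(congr1 (mulmx (invmx (A ^+ i - 1)))).
rewrite -mulmxE mulKmx ?subX1_unit // mulmx0 => E.
by rewrite -[RHS]E; apply: eq_bigr => k _; rewrite exprM.
Qed.

(** Irreducibility of [A ^+ i]: a proper stable subspace would be fixed pointwise, hence killed by
    the invertible [A ^+ i - 1]. *)
Lemma stable_full m (W : 'M[F]_(m, d)) i :
  ~~ (r %| i)%N -> W != 0 -> (W *m A ^+ i <= W)%MS -> row_full W.
Proof.
move=> ri W0; apply: contraTT => nf; apply: contra W0 => sW.
have rk : (\rank W < d)%N by rewrite ltn_neqAle rank_leq_col andbT.
have Air : (A ^+ i) ^+ r = 1 by rewrite -exprM mulnC exprM Ar expr1n.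
have fixW := small_stable_fixed Air rk sW.
rewrite -(mulmxK (subX1_unit ri) W) mulmxBr fixW.
by rewrite mulmx1 subrr mul0mx.
Qed.

(** * Discrete Fourier transform and common eigen-intertwiners *)

Section Fourier.

Variables (n : nat).
Implicit Types (X Y : 'M[F]_n) (T : 'M[F]_(d, n)).

(** When [X ^+ r = 1], this is [r] times the projection of [T] onto the fixed points of the operator
    sending [T] to [A ^+ j *m T *m X]. *)
Definition fourier X T j := \sum_(k < r) A ^+ (j * k) *m T *m X ^+ k.

Lemma fourier_eigen X T j : X ^+ r = 1 -> (j <= r)%N ->
  fourier X T j *m X = A ^+ (r - j) *m fourier X T j.
Proof.
move=> Xr jr; pose G k := A ^+ (j * k) *m T *m X ^+ k.
have E : A ^+ j *m (fourier X T j *m X) = fourier X T j.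
  (* The operator shifts the summation index by one, and the end terms [G 0] and [G r] agree because
     [A ^+ r = X ^+ r = 1]. *)
  rewrite mulmx_suml mulmx_sumr (eq_bigr (fun k : 'I_r => G k.+1)) => [|k _].
    have : \sum_(k < r.+1) G k = \sum_(k < r.+1) G k by [].
    rewrite [LHS]big_ord_recl [RHS]big_ord_recr /=.
    have -> : G r = G 0%N by rewrite /G muln0 Xr mulnC exprM Ar expr1n.
    by move/eqP; rewrite -subr_eq addrAC subrr add0r => /eqP.
  by rewrite /G mulnS exprD exprSr -!mulmxE !mulmxA.
by rewrite -[in RHS]E mulmxA expmx_mul subnK // Ar mul1mx.
Qed.

(** Summing over [j] first, [sum_powers0] kills every term except [k = 0]. *)
Lemma sum_fourier X T : \sum_(j < r) fourier X T j = r%:R *: T.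
Proof.
rewrite exchange_big /= (bigD1 (Ordinal r_gt0)) //= [X in _ + X]big1 => [|k].
  rewrite addr0 (eq_bigr (fun=> T)) ?sumr_const ?card_ord ?scaler_nat // => j _.
  by rewrite muln0 expr0 mul1mx mulmx1.
rewrite -val_eqE /= => k0; rewrite -mulmx_suml -mulmx_suml.
rewrite (eq_bigr (fun j : 'I_r => A ^+ (k * j))) => [|j _]; last by rewrite mulnC.
by rewrite sum_powers0 ?mul0mx // gtnNdvd ?lt0n.
Qed.

Lemma fourier_neq0 X T : T != 0 -> exists j : 'I_r, fourier X T j != 0.
Proof.
move=> T0; apply/existsP; apply: contraR T0; rewrite negb_exists => /forallP all0.
have := sum_fourier X T; rewrite big1 => [/esym/eqP|j _]; last first.
  by apply/eqP; rewrite -[_ == _]negbK all0.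
by rewrite scaler_eq0 (negPf r_neq0).
Qed.

Lemma fourier_comm X Y T i j : X *m Y = Y *m X ->
  T *m Y = A ^+ i *m T -> fourier X T j *m Y = A ^+ i *m fourier X T j.
Proof.
move=> cXY TY; rewrite mulmx_suml mulmx_sumr; apply: eq_bigr => k _.
rewrite -mulmxA (_ : X ^+ k *m Y = Y *m X ^+ k); last first.
  exact: expmx_intertwine.
by rewrite mulmxA -(mulmxA _ T) TY !mulmxA !expmx_mul addnC.
Qed.

(** Each [X] in turn replaces [T0] by a nonzero Fourier component. The last clause carries relations
    already obtained through the later replacements. *)
Lemma common_eigen (s : seq 'M[F]_n) T0 : T0 != 0 ->
    {in s, forall X, X ^+ r = 1} -> {in s &, forall X Y, X *m Y = Y *m X} ->
  exists T, [/\ T != 0, {in s, forall X, exists i, T *m X = A ^+ i *m T}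
    & forall Y i, {in s, forall X, X *m Y = Y *m X} ->
        T0 *m Y = A ^+ i *m T0 -> T *m Y = A ^+ i *m T].
Proof.
elim: s T0 => [|X s IHs] T0 nzT0 sr cs; first by exists T0.
have [j nzT1] := fourier_neq0 X nzT0.
have [||T [nzT eT cT]] := IHs _ nzT1.
- by move=> Y sY; apply: sr; rewrite inE sY orbT.
- by move=> Y Z sY sZ; apply: cs; rewrite inE ?sY ?sZ orbT.
exists T; split=> // [Y|Y i cY eY].
  rewrite inE => /orP[/eqP->|]; last exact: eT.
  exists (r - j)%N; apply: cT; last first.
    by apply: fourier_eigen; rewrite ?sr ?mem_head // ltnW.
  by move=> Z sZ; apply: cs; rewrite inE ?sZ ?eqxx ?orbT.
apply: cT => [Z sZ|]; first by apply: cY; rewrite inE sZ orbT.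
by apply: fourier_comm => //; apply: cY; rewrite mem_head.
Qed.

Lemma nontrivial_eigen X : X ^+ r = 1 -> X != 1 ->
  exists T i, [/\ T != 0, ~~ (r %| i)%N & T *m X = A ^+ i *m T].
Proof.
move=> Xr X1.
have /matrix0Pn[a [b nzab]] : X - 1 != 0 by rewrite subr_eq0.
have d_gt0 : (0 < d)%N.
  by case: (d) (A) A_neq1 => // B /eqP[]; apply/matrixP; case.
(* The first row of [T0] is a nonzero row of [X - 1]. The factor [X - 1] makes the component [j = 0]
   vanish, since the sum telescopes to [X ^+ r - 1 = 0]. *)
pose T0 := delta_mx (Ordinal d_gt0) a *m (X - 1).
have nzT0 : T0 != 0.
  apply: contra nzab => /eqP/matrixP/(_ (Ordinal d_gt0) b).
  rewrite mxE (bigD1 a) //= big1 => [|k ka]; first by rewrite !mxE !eqxx mul1r addr0 => /eqP.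
  by rewrite mxE (negPf ka) andbF mul0r.
have [j nzT] := fourier_neq0 X nzT0.
exists (fourier X T0 j), (r - j)%N; split=> //; last by rewrite fourier_eigen // ltnW.
rewrite dvdn_subr //; last exact: ltnW.
apply: contra nzT => rj; have j0 : j = 0%N :> nat.
  by apply/eqP; rewrite -[_ == _]negbK -lt0n; apply: contraL rj => ?; rewrite gtnNdvd.
rewrite /fourier (eq_bigr (fun k : 'I_r => T0 *m X ^+ k)) => [|k _]; last first.
  by rewrite j0 mul0n expr0 mul1mx.
by rewrite -mulmx_sumr -mulmxA mulmxE -subrX1 Xr subrr mulmx0.
Qed.

End Fourier.

(** * Splitting a block off a representation of an abelian group *)

Section Representations.

Variables (gT : finGroupType) (G : {group gT}).
Hypotheses (abG : abelian G) (expG : (exponent G %| r)%N).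

Lemma repr_exp n (f : gT -> 'M[F]_n) g :
  mx_repr G f -> g \in G -> f g ^+ r = 1.
Proof.
move=> [f1 fM] Gg; have fX k : f (g ^+ k)%g = f g ^+ k.
  by elim: k => [|k IHk]; rewrite ?f1 // expgS exprS fM ?groupX // IHk.
by rewrite -fX (exponentP expG) // f1.
Qed.

Lemma repr_comm n (f : gT -> 'M[F]_n) g h :
  mx_repr G f -> g \in G -> h \in G -> f g *m f h = f h *m f g.
Proof. by move=> [_ fM] Gg Gh; rewrite -!fM // (centsP abG). Qed.

Lemma card_neq0 : #|G|%:R != 0 :> F.
Proof.
have rG : (r.-group G)%g.
  by rewrite -pnat_exponent (pnat_dvd expG) // pnat_id.
have [k ->] := p_natP rG.
by rewrite natrX expf_neq0.
Qed.

(** Starting from a [T0] on which [h] acts by [A ^+ i] with [i] prime to [r], this relation survives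
    in [T]. The kernel of [T] is then stable under the irreducible [A ^+ i], and is zero because [T]
    is nonzero. *)
Lemma intertwiner_exists n (f : gT -> 'M[F]_n) h :
    mx_repr G f -> h \in G -> f h != 1 ->
  exists2 T : 'M_(d, n), row_free T &
    forall g, g \in G -> exists i, T *m f g = A ^+ i *m T.
Proof.
move=> fG Gh nz; have [T0 [i [nzT0 ri eT0]]] := nontrivial_eigen (repr_exp fG Gh) nz.
pose s := [seq f g | g <- enum G].
have sP X : X \in s -> exists2 g, g \in G & X = f g.
  by case/mapP=> g; rewrite mem_enum; exists g.
have [||T [nzT eT cT]] := @common_eigen n s T0 nzT0.
- by move=> X /sP[g Gg ->]; apply: repr_exp Gg.
- by move=> X Y /sP[g Gg ->] /sP[k Gk ->]; apply: repr_comm.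
exists T => [|g Gg]; last by apply: eT; apply: map_f; rewrite mem_enum.
have {}eT : T *m f h = A ^+ i *m T.
  by apply: cT eT0 => X /sP[g Gg ->]; apply: repr_comm.
rewrite -kermx_eq0; apply: contraR nzT => nzK.
have uK : kermx T \in unitmx.
  rewrite -row_full_unit; apply: stable_full ri nzK _; apply/sub_kermxP.
  by rewrite -mulmxA -eT mulmxA mulmx_ker mul0mx.
by rewrite -(mulKmx uK T) mulmx_ker mulmx0.
Qed.

Lemma sub_repr m n (f : gT -> 'M[F]_n) (a : gT -> 'M[F]_m) (T : 'M_(m, n)) :
    mx_repr G f -> row_free T -> {in G, forall g, T *m f g = a g *m T} ->
  mx_repr G a.
Proof.
move=> [f1 fM] fT eT; split=> [|g h Gg Gh]; apply: (row_free_inj fT).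
  by rewrite -eT // f1 mulmx1 mul1mx.
by rewrite -eT ?groupM // fM // mulmxA eT // -!mulmxA eT.
Qed.

(* Maschke's averaging. *)
Lemma equivariant_section m n (f : gT -> 'M[F]_n) (a : gT -> 'M[F]_m)
    (T : 'M_(m, n)) :
    mx_repr G f -> row_free T -> {in G, forall g, T *m f g = a g *m T} ->
  exists2 P : 'M_(n, m), T *m P = 1%:M & {in G, forall g, f g *m P = P *m a g}.
Proof.
move=> fG fT eT; have [a1 aM] := sub_repr fG fT eT; have [f1 fM] := fG.
have /row_freeP[P0 TP0] := fT.
pose P1 := \sum_(g in G) f g *m P0 *m a (g^-1)%g.
exists (#|G|%:R^-1 *: P1) => [|h Gh].
  rewrite -scalemxAr mulmx_sumr (eq_bigr (fun=> 1%:M)) => [|g Gg].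
    by rewrite sumr_const -scaler_nat scalerA mulVf ?scale1r // card_neq0.
  by rewrite !mulmxA eT // -(mulmxA _ T) TP0 mulmx1 -aM ?groupV // mulgV a1.
rewrite -scalemxAr -scalemxAl; congr (_ *: _); rewrite mulmx_sumr mulmx_suml.
rewrite [RHS](reindex_inj (mulgI h)) /=; apply: eq_big => g.
  by rewrite groupMl.
move=> Gg; rewrite fM // -!mulmxA; congr (_ *m (_ *m (_ *m _))).
by rewrite -aM ?groupV ?groupM // invMg -mulgA mulVg mulg1.
Qed.

(** The kernel of the equivariant section [P] is a stable complement to the row space of [T]; [Q]
    stacks bases of the two. *)
Lemma split_repr m n (f : gT -> 'M[F]_(m + n)) (a : gT -> 'M[F]_m)
    (T : 'M_(m, m + n)) :
    mx_repr G f -> row_free T -> {in G, forall g, T *m f g = a g *m T} ->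
  exists (b : gT -> 'M[F]_n) (Q : 'M_(m + n)),
    [/\ mx_repr G b, Q \in unitmx
      & {in G, forall g, Q *m f g = block_mx (a g) 0 0 (b g) *m Q}].
Proof.
move=> fG fT eT; have [P TP fP] := equivariant_section fG fT eT.
have rkP : \rank (kermx P) = n.
  have fP' : row_full P by apply/row_fullP; exists T.
  by rewrite mxrank_ker (eqP fP') addKn.
have [N fN eN] := basis_of_rank rkP.
have NP : N *m P = 0 by apply/sub_kermxP; rewrite eN.
have eNf g : g \in G -> N *m f g = (N *m f g *m pinvmx N) *m N.
  move=> Gg; rewrite mulmxKpV // eN; apply/sub_kermxP.
  by rewrite -mulmxA fP // mulmxA NP mul0mx.
exists (fun g => N *m f g *m pinvmx N), (col_mx T N); split.
- exact: sub_repr fG fN eNf.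
- rewrite -row_free_unit -kermx_eq0; apply/rowV0P => u /sub_kermxP.
  rewrite -[u]hsubmxK mul_row_col => uQ.
  have u1 : lsubmx u = 0.
    have := congr1 (mulmx^~ P) uQ.
    by rewrite mul0mx mulmxDl -!mulmxA TP NP mulmx0 mulmx1 addr0.
  move: uQ; rewrite u1 mul0mx add0r => uN.
  by rewrite (row_free_inj fN (_ : rsubmx u *m N = 0 *m N)) ?row_mx0 // mul0mx.
- by move=> g Gg; rewrite mul_col_mx mul_block_col !mul0mx addr0 add0r eT // -eNf.
Qed.

End Representations.

End MinimalDegree.

End FiniteOrderMatrices.

(** * One abelian matrix group absorbing all representations *)

Section Envelope.

Import GRing.Theory.
Local Set Implicit Arguments.
Local Unset Strict Implicit.
Local Unset Printing Implicit Defensive.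
Local Open Scope ring_scope.

Variables (F : finFieldType) (r : nat) (gT : finGroupType).
Hypotheses (r_pr : prime r) (r_neq0 : r%:R != 0 :> F).

Definition exponent_torus n (S : {set 'M[F]_n}) :=
  [/\ 1 \in S, {in S &, forall X Y, X *m Y \in S},
      {in S &, forall X Y, X *m Y = Y *m X} & {in S, forall X, X ^+ r = 1}].

(** Representations rather than matrix groups are quantified over, because the complementary block
    met in the induction may fail to be faithful. *)
Definition absorbs n (S : {set 'M[F]_n}) :=
  forall (G : {group gT}) (f : gT -> 'M[F]_n),
    abelian G -> (exponent G %| r)%N -> mx_repr G f ->
  exists2 P, P \in unitmx & {in G, forall g, P *m f g *m invmx P \in S}.

Lemma absorbs_trivial n :
    (forall B : 'M[F]_n, B ^+ r = 1 -> B = 1) ->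
  exists2 S : {set 'M[F]_n}, exponent_torus S & absorbs S.
Proof.
move=> triv; exists [set (1 : 'M[F]_n)].
  split=> [|X Y /set1P-> /set1P->|X Y /set1P-> /set1P->|X /set1P->] //.
  - exact: set11.
  - by rewrite mul1mx set11.
  - by rewrite expr1n.
move=> G f abG expG fG; exists 1 => [|g Gg]; first exact: unitmx1.
by rewrite (triv (f g) (repr_exp expG fG Gg)) mulmx1 mulmxV ?unitmx1 // inE.
Qed.

Lemma exponent_torus_block d n (A : 'M[F]_d) (S : {set 'M[F]_n}) :
    A ^+ r = 1 -> exponent_torus S ->
  exponent_torus [set block_mx (A ^+ i) 0 0 X | i : 'I_r, X : 'M[F]_n in S].
Proof.
move=> Ar [S1 SM Sc Sr]; set S' := (X in exponent_torus X).
have S'P i X : X \in S -> block_mx (A ^+ i) 0 0 X \in S'.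
  move=> SX; rewrite -(expmx_modr i Ar).
  by apply/imset2P; exists (Ordinal (ltn_pmod i (prime_gt0 r_pr))) X.
have bM i j (X Y : 'M[F]_n) :
    block_mx (A ^+ i) 0 0 X *m block_mx (A ^+ j) 0 0 Y =
    block_mx (A ^+ (i + j)) 0 0 (X *m Y).
  by rewrite mulmx_block !mulmx0 !mul0mx !addr0 !add0r expmx_mul.
split=> [|_ _ /imset2P[i X _ SX ->] /imset2P[j Y _ SY ->]
         |_ _ /imset2P[i X _ SX ->] /imset2P[j Y _ SY ->]|_ /imset2P[i X _ SX ->]].
- by have := S'P 0%N 1 S1; rewrite expr0 -scalar_mx_block.
- by rewrite bM S'P // SM.
- by rewrite !bM (addnC i) Sc.
- have bX k : block_mx (A ^+ i) 0 0 X ^+ k = block_mx (A ^+ (i * k)) 0 0 (X ^+ k).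
    elim: k => [|k IHk]; first by rewrite muln0 !expr0 -scalar_mx_block.
    by rewrite exprS IHk -mulmxE bM mulnS mulmxE -exprS.
  by rewrite bX Sr // mulnC exprM Ar expr1n -scalar_mx_block.
Qed.

Lemma torus_exists n : exists2 S : {set 'M[F]_n}, exponent_torus S & absorbs S.
Proof.
pose moved e := [exists B : 'M[F]_e, (B ^+ r == 1) && (B != 1)].
have unmoved e : ~~ moved e -> forall B : 'M[F]_e, B ^+ r = 1 -> B = 1.
  rewrite negb_exists => /forallP noB B /eqP Br; apply/eqP.
  by have := noB B; rewrite Br negbK.
have [mv | /unmoved/absorbs_trivial //] := boolP (moved n).
have [d /existsP[A /andP[/eqP Ar A1]] dmin] := ex_minnP (ex_intro _ n mv).
have {unmoved}dmin e (B : 'M[F]_e) : (e < d)%N -> B ^+ r = 1 -> B = 1.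
  by move=> ed; apply: unmoved; apply: contraL ed => /dmin; rewrite -leqNgt.
elim/ltn_ind: n {mv} => n IHn.
have [nd | dn] := ltnP n d; first exact: absorbs_trivial (fun B => dmin n B nd).
have d_gt0 : (0 < d)%N.
  by case: (d) (A) A1 => // B /eqP[]; apply/matrixP; case.
rewrite -(subnKC dn); set m := (n - d)%N.
have [|S ST Sabs] := IHn m; first by rewrite ltn_subrL d_gt0 (leq_trans d_gt0).
exists [set block_mx (A ^+ i) 0 0 X | i : 'I_r, X : 'M[F]_m in S].
  exact: exponent_torus_block.
move=> G f abG expG fG; have [S'1 _ _ _] := exponent_torus_block Ar ST.
(* A trivial representation yields no intertwiner from [A], but its only value [1] lies in the
   set. *)
have [/forall_inP triv | ] := boolP [forall g in G, f g == 1].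
  exists 1 => [|g Gg]; first exact: unitmx1.
  by rewrite (eqP (triv g Gg)) mulmx1 mulmxV ?unitmx1.
rewrite negb_forall => /existsP[h]; rewrite negb_imply => /andP[Gh fh].
have [T fT eT] := intertwiner_exists r_pr r_neq0 Ar A1 dmin abG expG fG Gh fh.
(* Exponents are reduced modulo [r] and chosen for all [g] at once, with the dummy value [0] outside
   [G]. *)
have /fin_all_exists[i Ti] :
    forall g, exists i : 'I_r, g \in G -> T *m f g = A ^+ i *m T.
  move=> g; have [/eT[i Ti] | _] := boolP (g \in G).
    exists (Ordinal (ltn_pmod i (prime_gt0 r_pr))) => _ /=.
    by rewrite expmx_modr.
  by exists (Ordinal (prime_gt0 r_pr)).
have [b [Q [bG uQ Qf]]] := split_repr r_pr r_neq0 expG fG fT Ti.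
have [P uP Pb] := Sabs G b abG expG bG.
have uP1 : (block_mx 1%:M 0 0 P : 'M[F]_(d + m)) \in unitmx.
  by rewrite unitmxE det_ublock det1 mul1r -unitmxE.
exists (block_mx 1%:M 0 0 P *m Q) => [|g Gg]; first by rewrite unitmx_mul uP1.
apply/imset2P; exists (i g) (P *m b g *m invmx P); [by [] | exact: Pb | ].
have -> : block_mx 1%:M 0 0 P *m Q *m f g =
    block_mx (A ^+ i g) 0 0 (P *m b g *m invmx P) *m (block_mx 1%:M 0 0 P *m Q).
  rewrite -mulmxA Qf // !mulmxA; congr (_ *m Q).
  by rewrite !mulmx_block !mulmx0 !mul0mx !addr0 !add0r mul1mx mulmx1 mulmxKV.
by rewrite mulmxK // unitmx_mul uP1.
Qed.

End Envelope.

(** * Transfer to subgroups of the general linear group *)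

Section ExponentSubgroupsOfGL.

Import GRing.Theory.
Local Open Scope group_scope.

Lemma GL_dominating_subgroup (r n : nat) (F : finFieldType) :
    prime r -> (r%:R != 0 :> F)%R ->
  exists2 E : {group {'GL_n[F]}}, in_abelian_exponent r E
    & forall H : {group {'GL_n[F]}}, in_abelian_exponent r H ->
        exists x, H \subset E :^ x.
Proof.
move=> r_pr r_neq0.
(* Elements of [{'GL_n[F]}] are matrices of size [n.-1.+1]. *)
have [S [S1 SM Sc Sr] Sabs] := torus_exists {'GL_n[F]} r_pr r_neq0 n.-1.+1.
have E_group : group_set [set g : {'GL_n[F]} | GLval g \in S].
  by apply/group_setP; split=> [|g h]; rewrite !inE // => Sg Sh; apply: SM.
exists (Group E_group) => [|H /andP[abH expH]].
  apply/andP; split; first apply/centsP=> g; last (apply/exponentP=> g);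
    rewrite inE => Sg.
    by move=> h; rewrite inE => Sh; apply: val_inj; apply: Sc.
  have vX k : GLval (g ^+ k) = (GLval g ^+ k)%R.
    by elim: k => [|k IHk] //; rewrite expgS GL_ME IHk exprS.
  by apply: val_inj; rewrite /= vX Sr.
(* [H] is absorbed through its tautological representation; the conjugating matrix [P] is the
   witness [x]. *)
have [|P uP PS] := Sabs H (@GLval n F) abH expH; first by split.
exists (FinRing.unit _ uP); apply/subsetP=> g Hg.
by rewrite mem_conjg conjgE invgK inE !GL_MxE GL_VxE mulmxA PS.
Qed.

End ExponentSubgroupsOfGL.

Theorem proposition3p2 (t r s k alpha : nat) (F : finFieldType)
  (ht : prime t) (hr : prime r) (htr : t <> r)
  (hk : (0 < k)%N) (hs : s = (t ^ k)%N) (hF : #|F| = s)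
  (halpha : (1 <= alpha)%N) :
  (#|conjugacy_classes 'GL_alpha[F]%G
       (maximal_abelian_exponent r 'GL_alpha[F]%G)| <= 1)%N.
Proof.
(* [F] has characteristic [t], a prime other than [r]. *)
have r_neq0 : (r%:R != 0 :> F)%R.
  apply/eqP=> r0; apply: htr; apply/eqP; rewrite -dvdn_prime2 //.
  have tF : t \in [pchar F]%R by apply: card_finPcharP ht; rewrite hF hs.
  by rewrite (GRing.dvdn_pcharf tF) r0.
have [E E_ab E_dom] := GL_dominating_subgroup r alpha F hr r_neq0.
have maxP H : H \in maximal_abelian_exponent r 'GL_alpha[F]%G ->
    exists x, H = (E :^ x)%G.
  rewrite inE => /maxgroupP[/andP[_ H_ab] H_max].
  (* The conjugate of [E] containing [H] is itself abelian of exponent dividing [r], so maximality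
     forces equality. *)
  have [x sHEx] := E_dom H H_ab; exists x; apply/esym/group_inj/H_max => //.
  rewrite subsetT /in_abelian_exponent abelianJ exponentJ.
  exact: E_ab.
rewrite leqNgt; apply/card_gt1P.
move=> -[_ [_ [/imsetP[H maxH ->] /imsetP[K maxK ->] /negP[]]]].
have [x ->] := maxP H maxH; have [y ->] := maxP K maxK.
have orbE z : orbit 'JG 'GL_alpha[F] (E :^ z)%G = orbit 'JG 'GL_alpha[F] E.
  by apply/orbit_eqP/imsetP; exists z; rewrite ?inE.
by rewrite !orbE.
Qed.
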